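(* Let $T\ge 0$ be an integer, let a discrete system be given, let $\Omega$ be the space of discrete functions $x(\cdot)$ from $\{-T,\dots,0,1,2,\dots\}$ to $\mathbb{R}$, and let $V(n,x)$ be a positive-valued Lyapunov function. Suppose there exist $q>0$ and $q_m$ such that the following two conditions hold for solutions $x(\cdot)\in\Omega$ of the given system and all times $t\ge 0$: (a) (Bounded difference condition) $V(t+1,x(t+1))\ge q_m V(t,x(t))$, with $q_m>0$; (b) (Razumikhin condition) if $V(t-\tau,x(t-\tau))\ge (1+q)^{-T}\frac{q_m}{1+q}V(t,x(t))$ for all $0\le\tau\le T$, then $V(t+1,x(t+1))\ge(1+q)V(t,x(t))$. Then for any solution $x(\cdot)\in\Omega$ of the system such that $V(t,x(t))\ge pV(0,x(0))$ for all $-T\le t\le 0$, where $0<p\le 1$, we have $$V(t,x(t))\ge(1+q)^t\,p\,V(0,x(0))\qquad\text{for all } t>0.$$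
   Context: A ''discrete system'' is any (time-delayed, with delay at most $T$) recursion determining which functions $x:\{-T,\dots,0,1,2,\dots\}\to\mathbb{R}$ are its solutions; only properties (a) and (b) of solutions are assumed. A positive-valued Lyapunov function is just a function $V(n,x)$ of time and state taking positive values. *)

(* Defs.v *)
From mathcomp Require Import all_boot all_order all_algebra.
From mathcomp Require Import reals.

Set Implicit Arguments.
Unset Strict Implicit.
Unset Printing Implicit Defensive.

Import Order.TTheory GRing.Theory Num.Theory.
Local Open Scope ring_scope.

(* A discrete function on {-T, ..., 0, 1, 2, ...} is represented by a total
   function [int -> R]; its values at times below -T are irrelevant: no
   definition below ever reads them. *)

(* A recursion with delay at most T: [S t h y] says that y is an admissible
   value of x(t+1) when x(t - tau) = h tau for all 0 <= tau <= T.  An explicit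
   recursion x(t+1) = f(t, x(t), ..., x(t-T)) is [fun t h y => y = f t h];
   a relation is used so that implicit recursions, and recursions that are
   not defined on all delayed states, are covered as well. *)
Definition discrete_system (R : realType) (T : nat) : Type :=
  int -> ('I_T.+1 -> R) -> R -> Prop.

Definition solution (R : realType) (T : nat) (S : discrete_system R T)
  (x : int -> R) : Prop :=
  forall t : int, 0 <= t -> S t (fun tau : 'I_T.+1 => x (t - (tau : nat)%:Z)) (x (t + 1)).

(* Values of V at times below -T are unconstrained, as such times do not
   belong to the time domain. *)
Definition positive_valued (R : realType) (T : nat) (V : int -> R -> R) : Prop :=
  forall (n : int) (s : R), - T%:Z <= n -> 0 < V n s.

Definition bounded_difference (R : realType) (T : nat)
  (S : discrete_system R T) (V : int -> R -> R) (qm : R) : Prop :=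
  forall x : int -> R, solution S x ->
  forall t : int, 0 <= t -> V (t + 1) (x (t + 1)) >= qm * V t (x t).

Definition razumikhin (R : realType) (T : nat)
  (S : discrete_system R T) (V : int -> R -> R) (q qm : R) : Prop :=
  forall x : int -> R, solution S x ->
  forall t : int, 0 <= t ->
  (forall tau : nat, (tau <= T)%N ->
     V (t - tau%:Z) (x (t - tau%:Z)) >=
       (1 + q) ^- T * (qm / (1 + q)) * V t (x t)) ->
  V (t + 1) (x (t + 1)) >= (1 + q) * V t (x t).

(* Main.v *)
(** Put [c = p V(0,x(0))] and show [V(t,x(t)) >= (1+q)^t c] for all [t >= -T],
    by strong induction.  In the step from [t] to [t+1], either the Razumikhin
    premise holds at [t] and [V] grows by the factor [1+q], or it fails at some
    delay [tau]; then the bounded difference condition gives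
    [V(t+1,x(t+1)) >= qm V(t,x(t)) > (1+q)^(T+1) V(t-tau,x(t-tau))
    >= (1+q)^(T+1+t-tau) c >= (1+q)^(t+1) c]. *)
Require Import Defs.
From mathcomp Require Import all_boot all_order all_algebra.
From mathcomp Require Import reals.
From mathcomp Require Import zify ring lra.
Import Order.TTheory GRing.Theory Num.Theory.
Local Open Scope ring_scope.

(** The factor [(1 + q) ^+ T.+1] cancels [(1 + q) ^- T / (1 + q)], leaving the [qm * v] of the
    bounded difference condition. *)
Lemma ler_of_razumikhin_failure (R : realFieldType) (T : nat) (q qm v w : R) :
  0 < q -> w <= (1 + q) ^- T * (qm / (1 + q)) * v ->
  (1 + q) ^+ T.+1 * w <= qm * v.
Proof.
move=> hq; have q1 : 0 < 1 + q by lra.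
have -> : qm * v = (1 + q) ^+ T.+1 * ((1 + q) ^- T * (qm / (1 + q)) * v).
  by rewrite exprS; field; rewrite expf_neq0 lt0r_neq0.
by rewrite ler_pM2l // exprn_gt0.
Qed.

(** Here [v t] stands for V(t, x(t)) along one solution. The integer power extends the bound to
    negative times, which the delayed terms reach. *)
Lemma razumikhin_growth (R : realFieldType) (T : nat) (q qm c : R)
  (v : int -> R) : 0 < q -> 0 <= c ->
  (forall t : int, 0 <= t -> qm * v t <= v (t + 1)) ->
  (forall t : int, 0 <= t ->
    (forall tau : nat, (tau <= T)%N ->
      (1 + q) ^- T * (qm / (1 + q)) * v t <= v (t - tau%:Z)) ->
    (1 + q) * v t <= v (t + 1)) ->
  (forall t : int, - T%:Z <= t -> t <= 0 -> c <= v t) ->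
  forall t : int, - T%:Z <= t -> (1 + q) ^ t * c <= v t.
Proof.
move=> hq c0 hdiff hraz hinit.
have q1 : 1 <= 1 + q by lra.
have q0 : 1 + q != 0 by lra.
(* Bounding [t] by [n] gives strong induction: [IHn] covers all times from -T to n. *)
suff main (n : nat) (t : int) : - T%:Z <= t -> t <= n%:Z -> (1 + q) ^ t * c <= v t.
  by move=> t ht; apply: (main `|t|%N) => //; lia.
elim: n t => [|n IHn] t hTt htn.
  apply: le_trans (hinit t hTt htn).
  by rewrite ler_piMl // -(expr0z (1 + q)) ler_weXz2l.
have [/IHn->//|ltnt] := lerP t n%:Z.
have -> : t = n%:Z + 1 by lia.
(* Quantifying over a finite type makes the premise decidable and yields a failing [tau]. *)
have [/forallP/= H|/forallPn/= [tau]] := boolP [forall tau : 'I_T.+1,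
    (1 + q) ^- T * (qm / (1 + q)) * v n%:Z <= v (n%:Z - (tau : nat)%:Z)].
  apply: (@le_trans _ _ ((1 + q) * v n%:Z)); last first.
    apply: hraz => [|tau]; first by lia.
    by rewrite -ltnS => htau; exact: (H (Ordinal htau)).
  rewrite expfzDr // expr1z mulrAC mulrC ler_pM2l; last by lra.
  by apply: IHn => //; lia.
have htau := ltn_ord tau.
rewrite -ltNge => /ltW/(ler_of_razumikhin_failure _ _ _ _ _ _ hq).
move=> hfail; apply: le_trans (hdiff n%:Z _); last by lia.
apply: le_trans hfail.
have /(ler_wpM2l (exprn_ge0 T.+1 (le_trans ler01 q1))) :
    (1 + q) ^ (n%:Z - (tau : nat)%:Z) * c <= v (n%:Z - (tau : nat)%:Z).
  by apply: IHn; lia.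
apply: le_trans; rewrite mulrA exprnP -expfzDr //.
(* Since tau <= T, the exponent T + 1 + n - tau is at least n + 1. *)
by rewrite ler_wpM2r // ler_weXz2l //; lia.
Qed.

Theorem theorem9 (R : realType) (T : nat) (S : discrete_system R T)
  (V : int -> R -> R) (hV : positive_valued T V)
  (q qm : R) (hq : 0 < q) (hqm : 0 < qm)
  (hdiff : bounded_difference S V qm)
  (hraz : razumikhin S V q qm) :
  forall (x : int -> R) (p : R), solution S x -> 0 < p -> p <= 1 ->
  (forall t : int, - T%:Z <= t -> t <= 0 -> V t (x t) >= p * V 0 (x 0)) ->
  forall t : int, 0 < t -> V t (x t) >= (1 + q) ^ t * p * V 0 (x 0).
Proof.
move=> x p solx p0 _ hinit t t0; rewrite -mulrA.
apply: (razumikhin_growth _ T q qm _ (fun s => V s (x s)) hq) => //.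
- by rewrite mulr_ge0 ?ltW // hV //; lia.
- by move=> s hs; exact: hdiff.
- by move=> s hs; exact: hraz.
- lia.
Qed.
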